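(* Let $m \geq 1$ be an integer and let $n$ be an even integer with $n \geq 2^m$. Then the hypercube $Q_n$ can be decomposed into cycles of length $2^m n$; that is, the edge set of $Q_n$ can be partitioned into the edge sets of cycles each having exactly $2^m n$ edges.
   Context: $Q_n$ is the $n$-dimensional hypercube: its vertices are the binary $n$-tuples (equivalently the subsets of $\{1,\dots,n\}$), and two vertices are adjacent iff they differ in exactly one coordinate. A decomposition of a graph $G$ is a collection of edge-disjoint subgraphs whose union contains every edge of $G$ exactly once; ''$G$ decomposes into $k$-cycles'' means such a collection in which every member is a cycle with $k$ edges. *)

(* Defs.v *)
From mathcomp Require Import all_boot.

Set Implicit Arguments.
Unset Strict Implicit.
Unset Printing Implicit Defensive.

(* A finite simple graph is given by a symmetric irreflexive adjacency
   relation; its edges are the two-element sets of adjacent vertices. *)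
Definition edge_set (T : finType) (e : rel T) : {set {set T}} :=
  [set [set p.1; p.2] | p in [pred p : T * T | e p.1 p.2]].

Definition cycle_edges (T : finType) (c : seq T) : {set {set T}} :=
  [set [set x; next c x] | x in c].

(* [ucycle e] also accepts closed walks with one or two vertices, which are
   not cycles of a simple graph, hence the bound on the size. *)
Definition is_graph_cycle (T : finType) (e : rel T) (k : nat) (c : seq T) : Prop :=
  [/\ ucycle e c, 3 <= size c & size c = k].

(* [partition] makes the members of [D] nonempty, pairwise disjoint and
   covering; a cycle is determined as a subgraph by its edge set. *)
Definition cycle_decomposition (T : finType) (e : rel T) (k : nat) (D : {set {set {set T}}}) : Prop :=
  partition D (edge_set e) /\
  forall E, E \in D -> exists2 c, is_graph_cycle e k c & E = cycle_edges c.

Definition decomposes_into_cycles (T : finType) (e : rel T) (k : nat) : Prop :=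
  exists D, cycle_decomposition e k D.

Definition hypercube (n : nat) : rel (n.-tuple bool) :=
  fun x y => #|[set i : 'I_n | tnth x i != tnth y i]| == 1.

Lemma hypercube_sym n : symmetric (@hypercube n).
Proof.
move=> x y; rewrite /hypercube; congr (_ == _); apply: eq_card => i.
by rewrite !inE eq_sym.
Qed.

Lemma hypercube_irr n : irreflexive (@hypercube n).
Proof.
move=> x; rewrite /hypercube (_ : [set i | _] = set0) ?cards0 //.
by apply/setP=> i; rewrite !inE eqxx.
Qed.

Lemma mem_edge_set (T : finType) (e : rel T) (x y : T) :
  symmetric e -> ([set x; y] \in edge_set e) = e x y.
Proof.
move=> se; apply/imsetP/idP => [[[a b] /= ab E]|xy]; last by exists (x, y).
move: ab; rewrite inE /= => ab.
have /set2P xab : x \in [set a; b] by rewrite -E set21.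
have /set2P yab : y \in [set a; b] by rewrite -E set22.
have /set2P axy : a \in [set x; y] by rewrite E set21.
have /set2P bxy : b \in [set x; y] by rewrite E set22.
by case: xab yab axy bxy => -> [] -> [] ? [] ?; subst; rewrite // se.
Qed.

Lemma card_cycle_edges (T : finType) (e : rel T) k c :
  is_graph_cycle e k c -> #|cycle_edges c| = k.
Proof.
case=> /andP[_ Uc] s3 <-; rewrite /cycle_edges card_in_imset.
  by apply/card_uniqP.
move=> x y xc yc /= exy.
apply/eqP; apply: contraT => nxy.
have yx : y = next c x.
  have : y \in [set x; next c x] by rewrite exy !inE eqxx.
  by rewrite !inE eq_sym (negPf nxy) => /eqP.
have xy : x = next c y.
  have : x \in [set y; next c y] by rewrite -exy !inE eqxx.
  by rewrite !inE (negPf nxy) => /eqP.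
have nn : next c (next c x) = x by rewrite -yx -xy.
have [i s Es] := rot_to xc.
have Us : uniq (x :: s) by rewrite -Es rot_uniq.
have : size (x :: s) = size c by rewrite -Es size_rot.
have nr z : next c z = next (x :: s) z by rewrite -Es next_rot.
move: nn; rewrite !nr.
case: s {Es nr} Us => [|a [|b s]] /=; first by move=> _ _ E; move: s3; rewrite -E.
  by move=> _ _ E; move: s3; rewrite -E.
rewrite !inE !negb_or -!andbA eqxx => /and5P[xa xb xs ab _].
rewrite (eq_sym a x) (negPf xa) eqxx.
by move=> bx; rewrite bx eqxx in xb.
Qed.

(* Main.v *)
(* A decomposition is carried along together with a marking of the cycles: each
   vertex is marked on some cycle, and each cycle has the same number M of
   marks, with 4 dividing M.  In the product with a 4-cycle, lift each cycle
   starting from a layer, moving to the next layer at each marked vertex and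
   marking there the vertex of entry.  Turning always in the same direction,
   the lift closes up after one round, since 4 divides M; turning the other
   way at the first mark only, it comes back to the opposite layer after one
   round and closes up after two, without meeting itself.  From Q_n to Q_(n+2)
   this turns cycles of length 2^m n with 2^(m+1) marks into cycles of length
   2^m (n+2) with 2^(m+1) marks, respectively 2^(m+1) (n+2) with 2^(m+2) marks.
   Starting from Q_2 one reaches all even n >= 2m, in particular n >= 2^m.
   Only covering has to be proved: disjointness follows by counting. *)
Require Import Defs.
From mathcomp Require Import all_boot zify.

Set Implicit Arguments.
Unset Strict Implicit.
Unset Printing Implicit Defensive.

(** * Arcs of closed walks and decompositions with marks *)

Definition arcs (T : Type) (c : seq T) : seq (T * T) :=
  if c is x :: p then pairmap pair (last x p) c else [::].

(** The default [z] never matters: a nonempty [c] has its own last vertex, an empty one has no arcs.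
    A cycle is thus handled like a path entered from its last vertex. *)
Lemma arcsE (T : Type) (z : T) c : arcs c = pairmap pair (last z c) c.
Proof. by case: c. Qed.

Lemma path_pairmap (T : eqType) (r : rel T) z s :
  reflect (forall p, p \in pairmap pair z s -> r p.1 p.2) (path r z s).
Proof.
elim: s z => [|y s IH] z /=; first by apply: ReflectT.
apply: (iffP andP) => [[rzy /IH sP] p|sP].
  by rewrite inE => /predU1P[->|/sP].
split; first by apply: (sP (z, y)); rewrite mem_head.
by apply/IH => p ps; apply: sP; rewrite inE ps orbT.
Qed.

Lemma mem_pairmap1 (T : eqType) (z : T) s p :
  p \in pairmap pair z s -> p.1 \in z :: s.
Proof.
elim: s z => [|y s IH] z //; rewrite [_ \in pairmap _ _ _]in_cons => /predU1P[->|/IH ps].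
  exact: mem_head.
by rewrite in_cons ps orbT.
Qed.

Lemma arcs_next (T : eqType) (c : seq T) p :
  uniq c -> p \in arcs c -> (p.1 \in c) /\ p.2 = next c p.1.
Proof.
case: c => [|x c] // Uc pc; split.
  have := mem_pairmap1 pc; rewrite inE => /predU1P[->|//].
  exact: mem_last.
have := cycle_next Uc; rewrite (cycle_path x) => /path_pairmap/(_ p pc).
by move/eqP.
Qed.

Definition covers (T : eqType) (c : seq T) (x y : T) :=
  ((x, y) \in arcs c) || ((y, x) \in arcs c).

Record marked_cycle (T : eqType) (e : rel T) (L M : nat) (s : seq (T * bool)) :
    Prop := MarkedCycle {
  marked_ucycle : ucycle e (unzip1 s);
  marked_size : size s = L;
  marked_count : count snd s = M }.

Definition marked_decomposition (T : eqType) (e : rel T) (K L M : nat) :=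
  exists D : seq (seq (T * bool)),
    [/\ size D = K, forall s, s \in D -> marked_cycle e L M s,
        forall x y, e x y -> exists2 s, s \in D & covers (unzip1 s) x y
      & forall x, exists2 s, s \in D & (x, true) \in s].

(** With [F] the set of edge sets of the cycles, covering gives
    [#|edge_set e| <= #|F| * L <= K * L]. The bound [K * L <= #|edge_set e|] forces equality, so no
    edge lies in two members of [F]. *)
Lemma marked_decomposition_decomposes (T : finType) (e : rel T) K L M :
  symmetric e -> 3 <= L -> K * L <= #|edge_set e| ->
  marked_decomposition e K L M -> decomposes_into_cycles e L.
Proof.
move=> se L3 leE [D [sD Dc Dcov _]].
have cyc s : s \in D -> is_graph_cycle e L (unzip1 s).
  by move=> /Dc[uc sz _]; split; rewrite ?size_map // sz.
pose ce (s : seq (T * bool)) := cycle_edges (unzip1 s).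
pose F := [set E in map ce D].
have cardF E : E \in F -> #|E| = L.
  by rewrite inE => /mapP[s /cyc sc ->]; apply: card_cycle_edges sc.
have coverF : cover F = edge_set e.
  apply/setP => E; apply/bigcupP/idP => [[B]|].
    rewrite inE => /mapP[s /Dc[/andP[cs _] _ _] ->] /imsetP[x xs ->].
    by rewrite mem_edge_set //; apply: next_cycle cs xs.
  case/imsetP => -[x y] /=; rewrite inE /= => /Dcov[s sD' sxy] ->.
  exists (ce s); first by rewrite inE map_f.
  have /andP[_ Us] := marked_ucycle (Dc _ sD').
  case/orP: sxy => /(arcs_next Us)[/= zs ->]; last rewrite setUC.
    exact: imset_f.
  exact: imset_f.
have sumF : \sum_(E in F) #|E| = #|F| * L.
  by rewrite (eq_bigr _ cardF) sum_nat_const.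
have leF : #|F| <= K by rewrite cardsE -sD -(size_map ce) card_size.
exists F; split; last first.
  move=> E; rewrite inE => /mapP[s /cyc sc ->].
  by exists (unzip1 s).
apply/and3P; split; first by rewrite coverF.
  (* Equality of the size of the cover with the sum of the sizes is equivalent to pairwise
     disjointness. *)
  have [le_sum <-] := leq_card_cover F.
  rewrite eqn_leq le_sum coverF sumF.
  by apply: leq_trans leE; rewrite leq_mul2r leF orbT.
by apply/negP => /cardF L0; rewrite -L0 cards0 in L3.
Qed.

Lemma marked_decomposition_iso (T T' : eqType) (e : rel T) (e' : rel T')
    (f : T -> T') (g : T' -> T) K L M :
  cancel f g -> cancel g f -> (forall x y, e' (f x) (f y) = e x y) ->
  marked_decomposition e K L M -> marked_decomposition e' K L M.
Proof.
move=> fK gK fe [D [sD Dc Dcov Dm]].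
pose h (p : T * bool) := (f p.1, p.2).
have unzip_h s : unzip1 (map h s) = map f (unzip1 s).
  by rewrite /unzip1 -!map_comp.
have arcs_f c : arcs (map f c) = [seq (f p.1, f p.2) | p <- arcs c].
  case: c => [|x c] //=; congr cons; first by rewrite last_map.
  by elim: c x => //= y c IH x; rewrite IH.
exists (map (map h) D); split; first by rewrite size_map.
- move=> _ /mapP[s /Dc[/andP[cs Us] sz ct] ->]; split.
  + rewrite unzip_h /ucycle map_inj_uniq ?Us; last exact: can_inj fK.
    by rewrite cycle_map (eq_cycle (e' := e)) ?cs.
  + by rewrite size_map.
  + by rewrite count_map -ct; apply: eq_count.
- move=> x y; rewrite -(gK x) -(gK y) fe => /Dcov[s sD' sc].
  exists (map h s); first exact: map_f.
  rewrite unzip_h /covers arcs_f.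
  by case/orP: sc => /(map_f (fun p => (f p.1, f p.2))) /= ->; rewrite ?orbT.
- move=> x; have [s sD' xs] := Dm (g x).
  exists (map h s); first exact: map_f.
  by rewrite -(gK x); apply: (map_f h xs).
Qed.

(** * The 4-cycle of layers and the lift of a marked cycle *)

(* Rotation of the 4-cycle on [bool * bool], in the direction [d]. *)
Definition turn (d : bool) (l : bool * bool) : bool * bool :=
  if d then (~~ l.2, l.1) else (l.2, ~~ l.1).

Definition opposite (l : bool * bool) : bool * bool := (~~ l.1, ~~ l.2).

Arguments turn : simpl never.
Arguments opposite : simpl never.

Definition square : rel (bool * bool) :=
  fun l k => (k == turn true l) || (l == turn true k).

Lemma turnK d : cancel (turn d) (turn (~~ d)).
Proof. by case: d => -[[] []]. Qed.

Lemma turnNK d : cancel (turn (~~ d)) (turn d).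
Proof. by case: d => -[[] []]. Qed.

Lemma turn_opposite d l : turn d (opposite l) = opposite (turn d l).
Proof. by case: d; case: l => [[] []]. Qed.

Lemma square_turn d l : square l (turn d l).
Proof. by case: d; case: l => [[] []]. Qed.

Lemma oppositeK : involutive opposite.
Proof. by case=> [[] []]. Qed.

Definition box (T U : eqType) (e : rel T) (r : rel U) : rel (T * U) :=
  fun p q => (p.1 == q.1) && r p.2 q.2 || e p.1 q.1 && (p.2 == q.2).

(** The parameter [d] governs the first turn only: after a mark the recursion continues with
    [true]. *)
Fixpoint lift (T : Type) (d : bool) (l : bool * bool) (s : seq (T * bool)) :
    seq (T * (bool * bool) * bool) :=
  if s is (v, b) :: s' then
    if b then [:: (v, l, true), (v, turn d l, false) & lift true (turn d l) s']
    else (v, l, false) :: lift d l s'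
  else [::].

Fixpoint exit_layer (T : Type) d l (s : seq (T * bool)) : bool * bool :=
  if s is (_, b) :: s' then
    if b then exit_layer true (turn d l) s' else exit_layer d l s'
  else l.

Section Lift.

Variable T : eqType.
Implicit Types (s : seq (T * bool)) (d : bool) (l k : bool * bool).

Lemma size_lift d l s : size (lift d l s) = size s + count snd s.
Proof.
elim: s d l => [|[v []] s IH] d l //=; rewrite IH; lia.
Qed.

Lemma count_lift d l s : count snd (lift d l s) = count snd s.
Proof. by elim: s d l => [|[v []] s IH] d l //=; rewrite IH. Qed.

Lemma last_lift d l s z :
  last (z, l) (unzip1 (lift d l s)) = (last z (unzip1 s), exit_layer d l s).
Proof. by elim: s d l z => [|[v []] s IH] d l z //=; rewrite IH. Qed.

Lemma exit_layer_true l s :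
  exit_layer true l s = iter (count snd s) (turn true) l.
Proof.
elim: s l => [|[v []] s IH] l //=; rewrite IH //.
by rewrite -iterSr.
Qed.

(** Since [turn false l] is [opposite (turn true l)] and [opposite] commutes with all later turns,
    reversing the first turn moves the exit to the opposite layer. *)
Lemma exit_layer_false l s :
  0 < count snd s ->
  exit_layer false l s = opposite (iter (count snd s) (turn true) l).
Proof.
have iter_opposite c k :
    iter c (turn true) (opposite k) = opposite (iter c (turn true) k).
  by elim: c => //= c ->; rewrite turn_opposite.
elim: s l => [|[v []] s IH] l //= c0; last exact: IH.
rewrite exit_layer_true -[RHS]/(opposite (iter _.+1 (turn true) l)) iterSr.
by rewrite -iter_opposite; case: l {c0} => [[] []].
Qed.

Lemma iter_turn4 c l : 4 %| c -> iter c (turn true) l = l.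
Proof.
case/dvdnP=> q ->; rewrite iterM.
by elim: q => // q IH; rewrite iterS IH; case: l {IH} => [[] []].
Qed.

Lemma path_lift (e : rel T) d l s z :
  path e z (unzip1 s) -> path (box e square) (z, l) (unzip1 (lift d l s)).
Proof.
elim: s d l z => [|[v []] s IH] d l z //= /andP[ezv /IH sP].
  by rewrite sP /box /= ezv !eqxx square_turn orbT.
by rewrite sP /box /= ezv eqxx orbT.
Qed.

Lemma mem_lift d l s p :
  p \in unzip1 (lift d l s) -> p.1 \in unzip1 s.
Proof.
elim: s d l => [|[v []] s IH] d l //=; rewrite !inE.
  by case/or3P=> [/eqP->|/eqP->|/IH->]; rewrite ?eqxx ?orbT.
by case/predU1P=> [->|/IH->]; rewrite ?eqxx ?orbT.
Qed.

Lemma uniq_lift d l s : uniq (unzip1 s) -> uniq (unzip1 (lift d l s)).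
Proof.
elim: s d l => [|[v b] s IH] d l //= /andP[vs /(IH _ _) U].
have vl d' k k' : (v, k') \notin unzip1 (lift d' k s).
  by apply: contra vs => /mem_lift.
case: b => /=; rewrite U vl ?andbT // inE (negPf (vl _ _ _)) orbF.
by rewrite xpair_eqE eqxx; case: d {U}; case: l => [[] []].
Qed.

(** The two lifts stay in opposite layers throughout; above a marked vertex each uses two adjacent
    layers, and these two pairs are disjoint. *)
Lemma disjoint_lift d l s p : uniq (unzip1 s) ->
  p \in unzip1 (lift d l s) -> p \notin unzip1 (lift d (opposite l) s).
Proof.
elim: s d l => [|[v b] s IH] d l //= /andP[vs Us].
have vl d' k k' : (v, k') \in unzip1 (lift d' k s) = false.
  by apply: contraNF vs => /mem_lift.
case: b => /=; rewrite !inE.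
  case/or3P=> [/eqP->|/eqP->|pl]; rewrite turn_opposite ?vl.
  - by rewrite !xpair_eqE eqxx; case: d l => -[[] []].
  - by rewrite !xpair_eqE eqxx; case: d l => -[[] []].
  - rewrite (negPf (IH _ _ Us pl)) orbF negb_or.
    by apply/andP; split; apply: contraTneq pl => ->; rewrite vl.
case/predU1P=> [->|pl]; first by rewrite vl xpair_eqE eqxx; case: l => [[] []].
rewrite (negPf (IH _ _ Us pl)) orbF.
by apply: contraTneq pl => ->; rewrite vl.
Qed.

(** Turns are invertible, so the layer wanted at [x] can be pulled back to a starting layer. The
    next two lemmas use the same device. *)
Lemma lift_entry d s x k : (x, true) \in s ->
  exists l, (x, k, true) \in lift d l s.
Proof.
elim: s d => [|[v b] s IH] d //; rewrite inE => /predU1P[[<- <-]|xs].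
  by exists k; rewrite /= mem_head.
case: b.
  have [l xl] := IH true xs; exists (turn (~~ d) l).
  by rewrite /= turnNK !inE xl !orbT.
by have [l xl] := IH d xs; exists l; rewrite /= inE xl orbT.
Qed.

Lemma lift_arc d s z p k : p \in pairmap pair z (unzip1 s) ->
  exists l, ((p.1, k), (p.2, k)) \in pairmap pair (z, l) (unzip1 (lift d l s)).
Proof.
elim: s d z => [|[v b] s IH] d z //; rewrite inE => /predU1P[->|ps].
  by exists k; case: b; rewrite /= mem_head.
case: b ps => ps.
  have [l xl] := IH true v ps; exists (turn (~~ d) l).
  by rewrite /= turnNK !inE xl !orbT.
by have [l xl] := IH d v ps; exists l; rewrite /= inE xl orbT.
Qed.

(** The direction [d0] depends only on whether the mark of [x] is the first one of [s], not on the
    layer [k]. *)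
Lemma lift_turn d s z x : (x, true) \in s ->
  exists d0, forall k, exists l,
    ((x, k), (x, turn d0 k)) \in pairmap pair (z, l) (unzip1 (lift d l s)).
Proof.
elim: s d z => [|[v b] s IH] d z //; rewrite inE => /predU1P[[<- <-]|xs].
  by exists d => k; exists k; rewrite /= !inE eqxx orbT.
case: b.
  have [d0 P] := IH true v xs; exists d0 => k; have [l xl] := P k.
  by exists (turn (~~ d) l); rewrite /= turnNK !inE xl !orbT.
have [d0 P] := IH d v xs; exists d0 => k; have [l xl] := P k.
by exists l; rewrite /= inE xl orbT.
Qed.

End Lift.

(** * Decomposing the product with a 4-cycle *)

Definition layers : seq (bool * bool) :=
  [:: (false, false); (true, false); (true, true); (false, true)].

Lemma mem_layers l : l \in layers.
Proof. by case: l => [[] []]. Qed.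

(* Each lift of a cycle of the decomposition has to appear, with the arc that
   leads to its first vertex, in some cycle of the new one. *)
Lemma box_square_decomposition (T : eqType) (e : rel T) d ls
    (F : seq (T * bool) -> bool * bool -> seq (T * (bool * bool) * bool))
    K L M L' M' :
  (forall s l, marked_cycle e L M s ->
     marked_cycle (box e square) L' M' (F s l)) ->
  (forall s l, marked_cycle e L M s -> exists2 k, k \in ls &
     {subset lift d l s <= F s k} /\
     forall z, {subset pairmap pair (last z (unzip1 s), l) (unzip1 (lift d l s))
                  <= arcs (unzip1 (F s k))}) ->
  marked_decomposition e K L M ->
  marked_decomposition (box e square) (K * size ls) L' M'.
Proof.
move=> Fc Fl [D [sD Dc Dcov Dm]].
exists [seq F s l | s <- D, l <- ls]; split.
- by rewrite size_allpairs sD.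
- by move=> _ /allpairsP[[s l] /= [/Dc sc _ ->]]; apply: Fc.
- have arcF s a z l : s \in D ->
      a \in pairmap pair (last z (unzip1 s), l) (unzip1 (lift d l s)) ->
      exists2 t, t \in [seq F s l | s <- D, l <- ls] & a \in arcs (unzip1 t).
    move=> sD' sa; have [k kls [_ sub]] := Fl s l (Dc _ sD').
    by exists (F s k); [apply: allpairs_f | apply: sub sa].
  move=> [x l] [y k] /orP[]/andP[/=].
    (* An edge inside the 4-cycle above [x] is covered by the turns made where [x] is marked. *)
    move=> /eqP<- lk; have [s sD' xs] := Dm x.
    have [d0 P] := lift_turn d (last x (unzip1 s)) xs.
    (* A rotation step in either direction is a [turn d0] from one of the two ends, and covering
       ignores orientation. *)
    have [] : k = turn d0 l \/ l = turn d0 k.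
      by case/orP: lk => /eqP ->; case: (d0); rewrite ?(turnK true); auto.
    + move=> ->; have [l0 /(arcF _ _ _ _ sD')[t tD tP]] := P l.
      by exists t => //; rewrite /covers tP.
    + move=> ->; have [l0 /(arcF _ _ _ _ sD')[t tD tP]] := P k.
      by exists t => //; rewrite /covers tP orbT.
  move=> exy /eqP<-; have [s sD' sxy] := Dcov _ _ exy.
  case/orP: sxy; rewrite (arcsE x);
    move=> /(lift_arc d l)[l0] /(arcF _ _ _ _ sD')[t tD tP].
    by exists t => //; rewrite /covers tP.
  by exists t => //; rewrite /covers tP orbT.
move=> [x l]; have [s sD' xs] := Dm x.
have [l0 xl] := lift_entry d l xs.
have [k kls [sub _]] := Fl s l0 (Dc _ sD').
by exists (F s k); [apply: allpairs_f | apply: sub].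
Qed.

Lemma box_square_same_marks (T : eqType) (e : rel T) K L M :
  4 %| M -> marked_decomposition e K L M ->
  marked_decomposition (box e square) (K * 4) (L + M) M.
Proof.
move=> M4.
have exitE s l : marked_cycle e L M s -> exit_layer true l s = l.
  by case=> _ _ ct; rewrite exit_layer_true ct iter_turn4.
apply: (@box_square_decomposition _ e true layers (fun s l => lift true l s)).
  move=> s l sc; have [/andP[cs Us] sz ct] := sc.
  split; rewrite ?size_lift ?count_lift ?sz ?ct // /ucycle uniq_lift // andbT.
  case: s sc cs {Us sz ct} => // x s sc.
  rewrite (cycle_path x.1) (cycle_path (x.1, l)) last_lift exitE //.
  exact: path_lift.
move=> s l sc; exists l; first exact: mem_layers.
split=> // z p; rewrite (arcsE (z, l)) last_lift exitE //.
Qed.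

Lemma box_square_double_marks (T : eqType) (e : rel T) K L M :
  0 < M -> 4 %| M -> marked_decomposition e K L M ->
  marked_decomposition (box e square) (K * 2) (2 * (L + M)) (2 * M).
Proof.
move=> M0 M4.
have exitE s l : marked_cycle e L M s -> exit_layer false l s = opposite l.
  by case=> _ _ ct; rewrite exit_layer_false ct // iter_turn4.
have lastK (z : T) c : last (last z c) c = last z c by case: c.
pose F (s : seq (T * bool)) l := lift false l s ++ lift false (opposite l) s.
have unzipF s l : unzip1 (F s l) =
    unzip1 (lift false l s) ++ unzip1 (lift false (opposite l) s).
  by rewrite /unzip1 map_cat.
have lastF s l z : marked_cycle e L M s ->
    last (z, l) (unzip1 (F s l)) = (last z (unzip1 s), l).
  move=> sc; rewrite unzipF last_cat last_lift exitE // last_lift exitE //.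
  by rewrite oppositeK lastK.
(* One starting layer is taken from each pair of opposite layers, as [F s l] contains both lifts. *)
apply: (@box_square_decomposition _ e false [:: (false, false); (true, false)] F).
  move=> s l sc; have [/andP[cs Us] sz ct] := sc; split.
  - apply/andP; split.
      case: s sc cs {Us sz ct} => // x s sc.
      rewrite (cycle_path x.1) (cycle_path (x.1, l)) lastF // unzipF.
      rewrite cat_path last_lift exitE // lastK => xs.
      by apply/andP; split; apply: path_lift.
    rewrite unzipF cat_uniq !uniq_lift // andbT /=.
    by apply/hasPn => p pl; apply/negP => /(disjoint_lift Us); rewrite pl.
  - by rewrite size_cat !size_lift sz ct; lia.
  - by rewrite count_cat !count_lift ct; lia.
move=> s l sc.
have F1 k : {subset lift false k s <= F s k}.
  by move=> p pk; rewrite mem_cat pk.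
have F2 k : {subset lift false (opposite k) s <= F s k}.
  by move=> p pk; rewrite mem_cat pk orbT.
(* The first lift exits in layer [opposite k], exactly where the second is entered, so the arcs
   split into those of the two lifts with their entering arcs. *)
have arcsF k z : arcs (unzip1 (F s k)) =
    pairmap pair (last z (unzip1 s), k) (unzip1 (lift false k s)) ++
    pairmap pair (last z (unzip1 s), opposite k)
      (unzip1 (lift false (opposite k) s)).
  by rewrite (arcsE (z, k)) lastF // unzipF pairmap_cat last_lift exitE // lastK.
have [lk|lk] : l \in [:: (false, false); (true, false)] \/
               opposite l \in [:: (false, false); (true, false)].
- by case: l => [[] []]; auto.
- exists l => //; split=> // z p pl.
  by rewrite (arcsF _ z) mem_cat pl.
exists (opposite l) => //; split.
  by rewrite -{1}[l]oppositeK.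
by move=> z p pl; rewrite (arcsF _ z) mem_cat oppositeK pl orbT.
Qed.

(** * Marked decompositions of hypercubes of even dimension *)

Lemma hypercubeE n (x y : n.-tuple bool) :
  hypercube x y = (\sum_(i < n) (tnth x i != tnth y i) == 1).
Proof.
rewrite /hypercube -sum1_card big_mkcond /=; congr (_ == 1).
by apply: eq_bigr => i _; rewrite inE; case: (_ != _).
Qed.

Lemma hypercube_cons n a b (x y : n.-tuple bool) :
  hypercube [tuple of a :: x] [tuple of b :: y] =
  if a == b then hypercube x y else x == y.
Proof.
rewrite !hypercubeE big_ord_recl !tnth0.
under eq_bigr => i _ do rewrite !tnthS.
case: (a == b); rewrite ?add0n // add1n eqSS sum_nat_eq0.
apply/forallP/eqP => [xy|-> i]; last by rewrite eqxx.
by apply: eq_from_tnth => i; have := xy i; rewrite eqb0 negbK => /eqP.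
Qed.

(** The first two coordinates serve as the layer, since [square] is the 2-dimensional cube. *)
Lemma marked_decomposition_hypercubeSS n K L M :
  marked_decomposition (box (@hypercube n) square) K L M ->
  marked_decomposition (@hypercube n.+2) K L M.
Proof.
pose f (p : n.-tuple bool * (bool * bool)) : n.+2.-tuple bool :=
  [tuple of p.2.1 :: [tuple of p.2.2 :: p.1]].
pose g (x : n.+2.-tuple bool) : n.-tuple bool * (bool * bool) :=
  ([tuple of behead [tuple of behead x]], (thead x, thead [tuple of behead x])).
apply: (marked_decomposition_iso (f := f) (g := g)).
- by move=> [x [a b]]; congr (_, _); apply: val_inj.
- by case/tupleP=> a /tupleP[b x]; apply: val_inj.
move=> [x [a b]] [y [c d]]; rewrite /f /box /square /= !hypercube_cons.
have -> : ([tuple of b :: x] == [tuple of d :: y]) = (b == d) && (x == y).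
  by rewrite -!val_eqE.
case: (x =P y) => [->|_]; rewrite ?hypercube_irr.
  by case: a b c d => [] [] [] [].
by case: a b c d => [] [] [] []; rewrite //= ?andbT ?andbF.
Qed.

Lemma marked_decomposition_hypercube2 :
  marked_decomposition (@hypercube 2) 1 4 4.
Proof.
pose v (a b : bool) : 2.-tuple bool := [tuple a; b].
have hypE a b c d : hypercube (v a b) (v c d) = (a != c) (+) (b != d).
  rewrite (hypercube_cons a c [tuple b] [tuple d]).
  rewrite (hypercube_cons b d [tuple] [tuple]) hypercube_irr.
  by case: a b c d => [] [] [] [].
have vP (x : 2.-tuple bool) : exists a b, x = v a b.
  case/tupleP: x => a x; case/tupleP: x => b x; exists a, b.
  by rewrite (tuple0 x); apply: val_inj.
pose s := [:: (v false false, true); (v true false, true);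
              (v true true, true); (v false true, true)].
exists [:: s]; split=> //.
- move=> _ /predU1P[->|//]; split=> //.
  by rewrite /ucycle /= !hypE.
- move=> x y; have [a [b ->]] := vP x; have [c [d ->]] := vP y.
  rewrite hypE => adj; exists s; first exact: mem_head.
  by case: a b c d adj => [] [] [] [].
move=> x; have [a [b ->]] := vP x; exists s; first exact: mem_head.
by case: a b => [] [].
Qed.

(** Induction on [n]: for [m] at most the previous [n] the marks are kept, and the diagonal case
    [m = n] comes from the previous diagonal case by doubling. The number of cycles is the number of
    edges divided by the length. *)
Lemma marked_decomposition_hypercube m n : 1 <= m -> m <= n ->
  marked_decomposition (@hypercube n.*2)
    (2 ^ (n.*2 - m.+1)) (2 ^ m * n.*2) (2 ^ m.+1).
Proof.
elim: n m => [|n IH] m m1 mn; first by case: m m1 mn.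
have dvd4 k : 1 <= k -> 4 %| 2 ^ k.+1 by move=> k1; apply: (@dvdn_exp2l 2 2).
rewrite doubleS; move: mn; rewrite leq_eqVlt => /predU1P[->|mn]; last first.
  have := box_square_same_marks (dvd4 _ m1) (IH _ m1 mn).
  move/marked_decomposition_hypercubeSS; congr marked_decomposition.
    by rewrite -(expnD 2 _ 2); congr (2 ^ _); lia.
  by rewrite expnS; lia.
case: n IH {m m1} => [|n] IH; first exact: marked_decomposition_hypercube2.
have n1 : 1 <= n.+1 by [].
have := box_square_double_marks (expn_gt0 2 _) (dvd4 _ n1) (IH _ n1 (leqnn _)).
move/marked_decomposition_hypercubeSS; congr marked_decomposition.
- by rewrite -(expnD 2 _ 1); congr (2 ^ _); lia.
- by rewrite !expnS; lia.
Qed.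

(** * Counting the edges of the hypercube, and the conclusion *)

Definition flip n (i : 'I_n) (x : n.-tuple bool) : n.-tuple bool :=
  [tuple tnth x j (+) (j == i) | j < n].

Lemma hypercube_flip n (i : 'I_n) x : hypercube x (flip i x).
Proof.
rewrite /hypercube -(cards1 i); apply/eqP; congr #|pred_of_set _|.
apply/setP => j; rewrite !inE tnth_mktuple.
by case: (tnth x j); case: (j == i).
Qed.

Lemma flip_inj n (i j : 'I_n) x : flip i x = flip j x -> i = j.
Proof.
move/(congr1 (fun t => tnth t i)); rewrite !tnth_mktuple eqxx.
by move/addbI => /esym/eqP.
Qed.

Lemma flipK n (i : 'I_n) : involutive (flip i).
Proof. by move=> x; apply: eq_from_tnth => j; rewrite !tnth_mktuple addbK. Qed.

(* An edge and the value of the coordinate flipped along it determine the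
   starting point. *)
Lemma card_hypercube_edges n : n * 2 ^ n <= #|edge_set (@hypercube n)| * 2.
Proof.
pose f (p : 'I_n * n.-tuple bool) := ([set p.2; flip p.1 p.2], tnth p.2 p.1).
have f_inj : injective f.
  move=> [i x] [j y] [/= /setP E xy].
  have := E y; rewrite !inE eqxx => /orP[]/eqP yE.
    subst y; congr (_, _); apply: (@flip_inj _ _ _ x).
    have := E (flip i x); rewrite !inE eqxx orbT => /esym/orP[/eqP ix|/eqP //].
    by have := hypercube_flip i x; rewrite ix hypercube_irr.
  have := E x; rewrite !inE eqxx yE => /esym/orP[/eqP ix|/eqP xj].
    by have := hypercube_flip i x; rewrite -ix hypercube_irr.
  have ij : i = j.
    by apply: (@flip_inj _ _ _ (flip i x)); rewrite flipK.
  by move: xy; rewrite yE -ij tnth_mktuple eqxx; case: (tnth _ _).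
have <- : #|[set f p | p in setT]| = n * 2 ^ n.
  by rewrite card_imset // cardsT card_prod card_ord card_tuple card_bool.
rewrite -card_bool -cardsT -cardsX; apply/subset_leq_card/subsetP.
move=> _ /imsetP[[i x] _ ->]; rewrite !inE andbT /=.
by rewrite mem_edge_set ?hypercube_flip //; apply: hypercube_sym.
Qed.

Theorem theorem1p1 (m n : nat) (hm : 1 <= m) (hn : ~~ odd n) (hmn : 2 ^ m <= n) :
  decomposes_into_cycles (@hypercube n) (2 ^ m * n).
Proof.
have nE : n = n./2.*2 by rewrite even_halfK.
have mn : m <= n./2.
  (* The chain [2m <= 2^m <= n] places [m] in the range of the induction. *)
  have : m.*2 <= 2 ^ m by elim: (m) => // -[|k] IH //; rewrite expnS; lia.
  lia.
have := marked_decomposition_hypercube hm mn; rewrite -nE.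
have le4 : 3 <= 2 ^ m * n.
  have : 2 ^ 1 <= 2 ^ m by rewrite leq_exp2l.
  nia.
apply: marked_decomposition_decomposes le4 _; first exact: hypercube_sym.
(* After doubling, the number of cycles times their length is exactly [n * 2 ^ n], the edge
   bound. *)
rewrite -(leq_pmul2r (isT : 0 < 2)) (leq_trans _ (card_hypercube_edges n)) //.
rewrite mulnAC [2 ^ m * n]mulnC mulnCA leq_mul2l.
rewrite -expnSr -expnD (_ : _ + m = n) ?leqnn ?orbT //.
by lia.
Qed.
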